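(* Let $p>2$, $0<\lambda<\Lambda$, and let $\Omega\subset\mathbb{R}^n$ be a bounded domain satisfying a uniform interior sphere condition. Then there exists $u_0\in C^1(\overline\Omega)$ with $u_0\ge0$ and $u_0|_{\partial\Omega}=0$ such that loss of boundary conditions occurs in a finite time $T=T(u_0,\Omega)$ for solutions $u$ of $$u_t-\mathcal{M}^-(D^2u)=|Du|^p\ \text{ in }\Omega\times(0,\infty),\qquad u=0\ \text{ on }\partial\Omega\times(0,\infty),\qquad u(\cdot,0)=u_0\ \text{ in }\overline\Omega,$$ where the boundary condition is understood in the viscosity sense.
   Context: $S(n)$ denotes the real symmetric $n\times n$ matrices with the usual ordering. For $0<\lambda<\Lambda$ and $X\in S(n)$, Pucci's minimal operator is $\mathcal{M}^-(X)=\inf\{\mathrm{tr}(AX): A\in S(n),\ \lambda I\le A\le\Lambda I\}$. Uniform interior sphere condition: there is a radius $\eta>0$ such that for every $x_0\in\partial\Omega$ there is an open ball of radius $\eta$ contained in $\Omega$ whose boundary contains $x_0$. A solution is a continuous function $u$ on $\overline\Omega\times[0,\infty)$ which is a viscosity solution of the equation in $\Omega\times(0,\infty)$, satisfies $u(\cdot,0)=u_0$ pointwise on $\overline\Omega$, and satisfies $u=0$ on $\partial\Omega\times(0,\infty)$ in the viscosity sense, that is: at points of $\partial\Omega\times(0,\infty)$, $$\min\big(u_t-\mathcal{M}^-(D^2u)-|Du|^p,\,u\big)\le 0\quad\text{and}\quad \max\big(u_t-\mathcal{M}^-(D^2u)-|Du|^p,\,u\big)\ge 0$$ hold in the viscosity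 sense (the first with derivatives replaced by those of any smooth test function touching $u$ from above at the point relative to $\overline\Omega\times(0,\infty)$, the second with those of any smooth test function touching $u$ from below). Loss of boundary conditions (LOBC) occurs when $u=0$ on the lateral boundary fails in the classical (pointwise) sense; LOBC at time $T$ means that $u(x,T)\ne0$ for some $x\in\partial\Omega$. *)

(* Defs.v *)
From HB Require Import structures.
From mathcomp Require Import all_boot all_order all_algebra.
From mathcomp Require Import all_classical all_reals all_analysis.

Set Implicit Arguments.
Unset Strict Implicit.
Unset Printing Implicit Defensive.

Import Order.TTheory GRing.Theory Num.Theory.
Import numFieldNormedType.Exports.

Local Open Scope classical_set_scope.
Local Open Scope ring_scope.

(* The norm of 'rV[R]_n in MathComp-Analysis is the sup norm, which has the
   topology and the bounded sets of R^n but not its balls or |Du|. *)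
Definition enorm {R : realType} {n : nat} (x : 'rV[R]_n) : R :=
  Num.sqrt (\sum_i x 0 i ^+ 2).

Definition eball {R : realType} {n : nat} (c : 'rV[R]_n) (r : R) :
    set 'rV[R]_n :=
  [set x | enorm (x - c) < r].

Definition boundary {T : topologicalType} (A : set T) : set T :=
  closure A `\` interior A.

Definition bounded_domain {R : realType} {n : nat} (Omega : set 'rV[R]_n) :
    Prop :=
  [/\ Omega !=set0, open Omega, connected Omega & bounded_set Omega].

Definition interior_sphere {R : realType} {n : nat} (Omega : set 'rV[R]_n) :
    Prop :=
  exists2 eta : R, 0 < eta &
    forall x0, boundary Omega x0 ->
      exists c, eball c eta `<=` Omega /\ boundary (eball c eta) x0.

Definition symmetric_mx {R : realType} {n : nat} (A : 'M[R]_n) : Prop :=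
  A^T = A.

Definition loewner_le {R : realType} {n : nat} (A B : 'M[R]_n) : Prop :=
  forall xi : 'rV[R]_n, (xi *m A *m xi^T) 0 0 <= (xi *m B *m xi^T) 0 0.

Definition pucci_min {R : realType} {n : nat} (lam Lam : R) (X : 'M[R]_n) : R :=
  inf [set \tr (A *m X) | A in
    [set A : 'M[R]_n | [/\ symmetric_mx A, loewner_le lam%:M A
                         & loewner_le A Lam%:M]]].

(* f is of class C^k on the open set U.  In finite dimension, continuity of
   all directional derivatives is the usual notion. *)
Fixpoint Ck {R : realType} {V : normedModType R} (k : nat) (U : set V)
    (f : V -> R) : Prop :=
  (forall x, U x -> {for x, continuous f}) /\
  (if k is k'.+1 then
     forall v, (forall x, U x -> derivable f x v) /\ Ck k' U ('D_v f)
   else True).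

Definition smooth_at {R : realType} {V : normedModType R} (f : V -> R) (z : V) :
    Prop :=
  exists U : set V, [/\ open U, U z & forall k, Ck k U f].

(* C^1 up to the boundary: f is continuous on the closure of Omega and its
   derivatives in Omega extend continuously to the closure. *)
Definition C1_closure {R : realType} {n : nat} (Omega : set 'rV[R]_n)
    (f : 'rV[R]_n -> R) : Prop :=
  {within closure Omega, continuous f} /\
  forall v, (forall x, Omega x -> derivable f x v) /\
    exists g : 'rV[R]_n -> R, {within closure Omega, continuous g} /\
      forall x, Omega x -> 'D_v f x = g x.

(* Space-time points (x, t) are pairs in 'rV[R]_n * R. *)

Definition time_deriv {R : realType} {n : nat} (phi : 'rV[R]_n * R -> R)
    (z : 'rV[R]_n * R) : R :=
  'D_(0, 1) phi z.

Definition space_deriv {R : realType} {n : nat} (i : 'I_n)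
    (phi : 'rV[R]_n * R -> R) (z : 'rV[R]_n * R) : R :=
  'D_(delta_mx 0 i, 0) phi z.

Definition space_grad {R : realType} {n : nat} (phi : 'rV[R]_n * R -> R)
    (z : 'rV[R]_n * R) : 'rV[R]_n :=
  \row_i space_deriv i phi z.

Definition space_hess {R : realType} {n : nat} (phi : 'rV[R]_n * R -> R)
    (z : 'rV[R]_n * R) : 'M[R]_n :=
  \matrix_(i, j) space_deriv i (space_deriv j phi) z.

(* phi_t - M^-(D^2 phi) - |D phi|^p *)
Definition pde_op {R : realType} {n : nat} (lam Lam p : R)
    (phi : 'rV[R]_n * R -> R) (z : 'rV[R]_n * R) : R :=
  time_deriv phi z - pucci_min lam Lam (space_hess phi z)
    - enorm (space_grad phi z) `^ p.

Definition touches_above {R : realType} {n : nat} (D : set ('rV[R]_n * R))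
    (u phi : 'rV[R]_n * R -> R) (z : 'rV[R]_n * R) : Prop :=
  [/\ smooth_at phi z, phi z = u z & \forall y \near z, D y -> u y <= phi y].

Definition touches_below {R : realType} {n : nat} (D : set ('rV[R]_n * R))
    (u phi : 'rV[R]_n * R -> R) (z : 'rV[R]_n * R) : Prop :=
  [/\ smooth_at phi z, phi z = u z & \forall y \near z, D y -> phi y <= u y].

Definition viscosity_solution {R : realType} {n : nat} (lam Lam p : R)
    (Omega : set 'rV[R]_n) (u : 'rV[R]_n * R -> R) : Prop :=
  let Q := Omega `*` [set t : R | 0 < t] in
  forall z, Q z ->
    (forall phi, touches_above Q u phi z -> pde_op lam Lam p phi z <= 0) /\
    (forall phi, touches_below Q u phi z -> 0 <= pde_op lam Lam p phi z).

Definition viscosity_zero_boundary {R : realType} {n : nat} (lam Lam p : R)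
    (Omega : set 'rV[R]_n) (u : 'rV[R]_n * R -> R) : Prop :=
  let Qbar := closure Omega `*` [set t : R | 0 < t] in
  forall z, (boundary Omega `*` [set t : R | 0 < t]) z ->
    (forall phi, touches_above Qbar u phi z ->
       Num.min (pde_op lam Lam p phi z) (u z) <= 0) /\
    (forall phi, touches_below Qbar u phi z ->
       0 <= Num.max (pde_op lam Lam p phi z) (u z)).

(* Values of u outside closure Omega * [0, +oo[ are irrelevant. *)
Definition is_solution {R : realType} {n : nat} (lam Lam p : R)
    (Omega : set 'rV[R]_n) (u0 : 'rV[R]_n -> R) (u : 'rV[R]_n * R -> R) : Prop :=
  [/\ {within closure Omega `*` [set t : R | 0 <= t], continuous u},
      viscosity_solution lam Lam p Omega u,
      viscosity_zero_boundary lam Lam p Omega u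
    & forall x, closure Omega x -> u (x, 0) = u0 x].

Definition LOBC_at {R : realType} {n : nat} (Omega : set 'rV[R]_n)
    (u : 'rV[R]_n * R -> R) (T : R) : Prop :=
  exists2 x, boundary Omega x & u (x, T) != 0.

(* Main.v *)
Require Import Defs.
From mathcomp Require Import all_boot all_order all_algebra.
From mathcomp Require Import all_classical all_reals all_analysis.
From mathcomp Require Import ring lra.

Import Order.TTheory GRing.Theory Num.Theory.
Import numFieldNormedType.Exports.

Local Open Scope classical_set_scope.
Local Open Scope ring_scope.

(** The loss of the boundary condition is forced by an explicit barrier living
    in one interior ball B of centre c and radius eta that touches the boundary
    of Omega at a point x0.  Put s = eta^2 - |x - c|^2 and, on B x (0, 2T),
    consider
      w = m0 - m1 t + (a0 - b t) s + C s^be - eps / s - eps / (2T - t),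
    with be = 1 - 1/(p-1).

    The two eps-terms send w to -oo at the lateral boundary and at the final
    time.  Therefore, whatever the values of u on the boundary, u - w attains
    a negative minimum at an interior point, where w touches u from below up
    to a constant; if w is a strict subsolution lying below u at time 0 this
    is impossible, so w <= u ([strict_subsolution_le]).

    Why w is a strict subsolution ([barrier_strict_subsolution]): let G be the
    derivative of w in s, so that |Dw| = 2 G |x - c|.  The second derivative of
    w in s has absolute value at most 2 G / s, hence the second-order terms are
    at most a constant times G / s.  The term C s^be gives G^(p-1) >= const / s,
    hence |Dw|^p >= const G / s away from the centre, and half of |Dw|^p absorbs
    the second-order terms up to the sphere, uniformly in eps.  Here p > 2
    enters: it makes be positive, so that C s^be, whose slope is infinite at
    the sphere, is bounded.  The other half of |Dw|^p, of order a0^p, pays for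
    the growth of w, of order a0, once a0 is large.  Near the centre the
    gradient vanishes and w has to decrease, but only at a rate proportional to
    a0; over a time T independent of a0 this costs little, whereas flattening
    the paraboloid (a0 - b t) s lifts w near the sphere by more.

    The outcome ([ball_growth]): as eps tends to 0 the value of w on the sphere
    passes from - a0 eta^2 / 8 at time 0 to kappa = a0 eta^2 / 32 at time T,
    while the initial profile of w lies below L s^2.  So with u0 equal to
    L s^2 in B and 0 elsewhere, which is C^1, u(., T) >= kappa in B, and by
    continuity u(x0, T) >= kappa > 0. *)

(** * Calculus of C^k functions *)

Lemma is_derive_linear {R : realType} {V : normedModType R} (L : V -> R)
    (x v : V) :
  (forall k y, L (k *: v + y) = k * L v + L y) -> is_derive x v L (L v).
Proof.
move=> Llin.
have Lcvg : h^-1 *: ((L \o shift x) (h *: v) - L x) @[h --> 0^'] --> L v.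
  apply: cvg_near_cst; near=> h.
  rewrite /= Llin addrK /GRing.scale/= mulrA mulVf ?mul1r//.
  by near: h; exact: nbhs_dnbhs_neq.
by apply: DeriveDef; [apply/cvg_ex; exists (L v) | apply: cvg_lim].
Unshelve. all: by end_near. Qed.

(** Reduces directional derivatives to derivatives in one real variable, for
    which the chain rule is known. *)
Lemma is_derive_lineP {R : realType} {V : normedModType R} (f : V -> R)
    (l : R -> R) (x v : V) (df : R) : (forall h, l h = f (h *: v + x)) ->
  is_derive x v f df <-> is_derive (0 : R) 1 l df.
Proof.
move=> lE.
have dE : 'D_v f x = 'D_1 l 0.
  rewrite /derive; set F1 := fun h => _; set F2 := fun h => _.
  suff -> : F1 = F2 by [].
  apply/funext => h; rewrite /F1 /F2 /= !lE scale0r add0r addr0.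
  by rewrite [_%:A]mulr1.
have dlP : derivable f x v <-> derivable l 0 1.
  have -> : l = fun h => f (h *: v + x) by apply/funext.
  exact: derivable1P.
split => -[dx <-]; first exact: (DeriveDef (dlP.1 dx) (esym dE)).
exact: (DeriveDef (dlP.2 dx) dE).
Qed.

Lemma is_derive_comp1 {R : realType} {V : normedModType R} (g : R -> R)
    (f : V -> R) (x v : V) (df dg : R) :
  is_derive x v f df -> is_derive (f x) 1 g dg ->
  is_derive x v (g \o f) (dg * df).
Proof.
have [l lE] : exists l : R -> R, forall h, l h = f (h *: v + x) by eexists.
have l0 : f x = l 0 by rewrite lE scale0r add0r.
move=> /(is_derive_lineP _ _ _ _ _ lE) fl; rewrite l0 => gl.
apply/(is_derive_lineP _ (g \o l)); first by move=> h; rewrite /= lE.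
Qed.

Section Ck_calculus.
Context {R : realType} {V : normedModType R} {U : set V}.
Hypothesis Uopen : open U.
Implicit Types (f g : V -> R) (k : nat).

Lemma near_eq_on f g x : {in U, f =1 g} -> U x -> {near x, f =1 g}.
Proof.
move=> fg Ux; near=> y; apply: fg; apply/mem_set; near: y.
exact: open_nbhs_nbhs.
Unshelve. all: by end_near. Qed.

Lemma derivable_eq_on f g v x : {in U, f =1 g} -> U x ->
  derivable f x v -> derivable g x v.
Proof. by move=> fg Ux; apply: near_eq_derivable; exact: near_eq_on. Qed.

Lemma derive_eq_on f g v x : {in U, f =1 g} -> U x -> 'D_v f x = 'D_v g x.
Proof. by move=> fg Ux; apply: near_eq_derive; exact: near_eq_on. Qed.

Lemma continuous_eq_on f g : {in U, f =1 g} ->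
  (forall x, U x -> {for x, continuous f}) ->
  (forall x, U x -> {for x, continuous g}).
Proof.
move=> fg fc x Ux; have := fc x Ux.
move=> fcx; have : f @ x --> g x by rewrite -(fg x (mem_set Ux)).
move=> fgx; apply: cvg_trans fgx; apply: near_eq_cvg.
exact: near_eq_on.
Qed.

Lemma Ck_ext k f g : {in U, f =1 g} -> Ck k U f -> Ck k U g.
Proof.
elim: k f g => [|k IH] f g fg [fc fd].
  by split => //; exact: (continuous_eq_on f g).
split; first exact: (continuous_eq_on f g).
move=> v; have [dv Cv] := fd v; split.
  by move=> x Ux; exact: (derivable_eq_on f g v x fg Ux (dv x Ux)).
apply: (IH ('D_v f)) => // x xU; apply: (derive_eq_on f g v x fg).
exact: set_mem.
Qed.

Lemma Ck_W k f : Ck k.+1 U f -> Ck k U f.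
Proof.
elim: k f => [|k IH] f [fc fd]; split => // v.
by have [dv Cv] := fd v; split => //; exact: IH.
Qed.

(** The way smoothness is established below: the derivatives of a function are
    expressed by a formula whose regularity is known by induction. *)
Lemma Ck_is_derive k f (df : V -> V -> R) :
  (forall x, U x -> {for x, continuous f}) ->
  (forall v x, U x -> is_derive x v f (df v x)) ->
  (forall v, Ck k U (df v)) -> Ck k.+1 U f.
Proof.
move=> fc fd Cd; split => // v; split; first by move=> x Ux; case: (fd v x Ux).
apply: Ck_ext (Cd v) => x /set_mem Ux.
by case: (fd v x Ux).
Qed.

Lemma Ck_cst k (a : R) : Ck k U (cst a).
Proof.
have ac x : {for x, continuous (cst a : V -> R)} by exact: cvg_cst.
elim: k a ac => [|k IH] a ac; first by split.
apply: (@Ck_is_derive k _ (fun=> cst 0)) => // v; apply: IH => x.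
exact: cvg_cst.
Qed.

Lemma CkD k f g : Ck k U f -> Ck k U g -> Ck k U (fun x => f x + g x).
Proof.
elim: k f g => [|k IH] f g [fc fd] [gc gd].
  by split => // x Ux; apply: continuousD; [exact: fc|exact: gc].
apply: (@Ck_is_derive k _ (fun v x => 'D_v f x + 'D_v g x)).
- by move=> x Ux; apply: continuousD; [exact: fc|exact: gc].
- move=> v x Ux; apply: is_deriveD; apply: derivableP.
  + exact: (fd v).1.
  + exact: (gd v).1.
- by move=> v; apply: IH; [exact: (fd v).2|exact: (gd v).2].
Qed.

Lemma CkM k f g : Ck k U f -> Ck k U g -> Ck k U (fun x => f x * g x).
Proof.
elim: k f g => [|k IH] f g Cf Cg.
  case: Cf Cg => fc _ [gc _].
  by split => // x Ux; apply: continuousM; [exact: fc|exact: gc].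
have [[fc fd] [gc gd]] := (Cf, Cg).
apply: (@Ck_is_derive k _ (fun v x => f x * 'D_v g x + g x * 'D_v f x)).
- by move=> x Ux; apply: continuousM; [exact: fc|exact: gc].
- move=> v x Ux; apply: is_deriveM; apply: derivableP.
  + exact: (fd v).1.
  + exact: (gd v).1.
- move=> v; apply: CkD; apply: IH; try exact: Ck_W.
  + exact: (gd v).2.
  + exact: (fd v).2.
Qed.

Lemma CkN k f : Ck k U f -> Ck k U (fun x => - f x).
Proof.
move=> Cf; rewrite (_ : (fun x => - f x) = (fun x => cst (-1) x * f x)).
  by apply: CkM => //; exact: Ck_cst.
by apply/funext => x; rewrite mulN1r.
Qed.

Lemma CkB k f g : Ck k U f -> Ck k U g -> Ck k U (fun x => f x - g x).
Proof. by move=> Cf Cg; apply: CkD => //; exact: CkN. Qed.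

Lemma Ck_sum k n (f : 'I_n -> V -> R) : (forall i, Ck k U (f i)) ->
  Ck k U (fun x => \sum_i f i x).
Proof.
move=> Cf; elim: n f Cf => [|n IH] f Cf.
  rewrite (_ : (fun x => _) = cst 0); first exact: Ck_cst.
  by apply/funext => x; rewrite big_ord0.
rewrite (_ : (fun x => _) =
    (fun x => \sum_(i < n) f (widen_ord (leqnSn n) i) x + f ord_max x)).
  by apply: CkD => //; apply: IH.
by apply/funext => x; rewrite big_ord_recr.
Qed.

Lemma Ck_linear k f : continuous f ->
  (forall a x y, f (a *: x + y) = a * f x + f y) -> Ck k U f.
Proof.
move=> fc flin; case: k => [|k]; first by split => // x _; exact: fc.
apply: (@Ck_is_derive k _ (fun v => cst (f v))); first by move=> x _; exact: fc.
- by move=> v x _; apply: is_derive_linear => a y; exact: flin.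
- by move=> v; exact: Ck_cst.
Qed.

Lemma is_derive_powRf f (r : R) (x v : V) (df : R) :
  0 < f x -> is_derive x v f df ->
  is_derive x v (fun y => f y `^ r) (r * f x `^ (r - 1) * df).
Proof.
move=> fx0 fd; rewrite (_ : (fun y => _) = (fun y => y `^ r) \o f) //.
by apply: is_derive_comp1 => //; exact: is_derive1_powR.
Qed.

Lemma continuous_powRf f (r : R) (x : V) : 0 < f x ->
  {for x, continuous f} -> {for x, continuous (fun y => f y `^ r)}.
Proof.
move=> fx0 fc; apply: (@continuous_comp _ _ _ f (fun y => y `^ r)) => //.
apply: differentiable_continuous; apply/derivable1_diffP.
by have [] := is_derive1_powR r fx0.
Qed.

(** The exponent is arbitrary because differentiation shifts it by one. *)
Lemma Ck_powR k f (r : R) : (forall x, U x -> 0 < f x) -> Ck k U f ->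
  Ck k U (fun x => f x `^ r).
Proof.
move=> f0; elim: k r => [|k IH] r Cf.
  case: Cf => fc _.
  by split => // x Ux; apply: continuous_powRf; [exact: f0|exact: fc].
have [fc fd] := Cf.
apply: (@Ck_is_derive k _ (fun v x => r * f x `^ (r - 1) * 'D_v f x)).
- by move=> x Ux; apply: continuous_powRf; [exact: f0|exact: fc].
- move=> v x Ux; apply: is_derive_powRf; first exact: f0.
  by apply: derivableP; exact: (fd v).1.
- move=> v; apply: CkM; last exact: (fd v).2.
  by apply: CkM; [exact: Ck_cst|apply: IH; exact: Ck_W].
Qed.

End Ck_calculus.

(** * Euclidean norm, Pucci operator and depth in a ball *)

Lemma enorm_ge0 {R : realType} {n : nat} (x : 'rV[R]_n) : 0 <= enorm x.
Proof. exact: sqrtr_ge0. Qed.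

Lemma enorm_sqr {R : realType} {n : nat} (x : 'rV[R]_n) :
  enorm x ^+ 2 = \sum_i x 0 i ^+ 2.
Proof. by rewrite sqr_sqrtr //; apply: sumr_ge0 => i _; exact: sqr_ge0. Qed.

Lemma enormZ {R : realType} {n : nat} (k : R) (x : 'rV[R]_n) :
  enorm (k *: x) = `|k| * enorm x.
Proof.
rewrite /enorm -sqrtr_sqr -sqrtrM ?sqr_ge0//; congr Num.sqrt.
by rewrite mulr_sumr; apply: eq_bigr => i _; rewrite mxE exprMn.
Qed.

(** Every competitor A has trace at most n Lam and quadratic form at y at most
    Lam |y|^2, which bounds the trace of its product with the matrix from
    below. *)
Lemma pucci_min_ge {R : realType} {n : nat} (lam Lam G H : R) (y : 'rV[R]_n) :
  lam <= Lam -> 0 <= G -> 0 <= H ->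
  - (Lam * (n%:R * G + H * enorm y ^+ 2)) <=
  pucci_min lam Lam (- (G%:M + H *: (y^T *m y))).
Proof.
move=> lL G0 H0; apply: lb_le_inf.
  exists (\tr (Lam%:M *m (- (G%:M + H *: (y^T *m y))))), Lam%:M => //.
  split; [exact: tr_scalar_mx| |by move=> xi].
  move=> xi; rewrite !mul_mx_scalar -!scalemxAl !mxE ler_wpM2r //.
  by apply: sumr_ge0 => i _; rewrite mxE -expr2 sqr_ge0.
move=> _ [A [_ _ AL] <-].
rewrite mulmxN mulmxDr mul_mx_scalar -scalemxAr linearN linearD /= !mxtraceZ.
have -> : \tr (A *m (y^T *m y)) = (y *m A *m y^T) 0 0.
  by rewrite mulmxA mxtrace_mulC mulmxA /mxtrace big_ord1.
have trA : \tr A <= n%:R * Lam.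
  rewrite /mxtrace mulr_natl -[X in _ *+ X]card_ord -sumr_const ler_sum// => i _.
  have := AL (delta_mx 0 i).
  rewrite mul_mx_scalar -scalemxAl -!rowE trmx_delta -!colE !mxE !eqxx.
  by rewrite mulr1.
have yA : (y *m A *m y^T) 0 0 <= Lam * enorm y ^+ 2.
  apply: le_trans (AL y) _; rewrite mul_mx_scalar -scalemxAl mxE enorm_sqr.
  rewrite le_eqVlt; apply/orP; left; apply/eqP; congr (_ * _).
  by rewrite mxE; apply: eq_bigr => i _; rewrite mxE expr2.
rewrite lerN2 (_ : Lam * _ = G * (n%:R * Lam) + H * (Lam * enorm y ^+ 2)).
  by rewrite lerD // ler_wpM2l.
by ring.
Qed.

Section depth.
Context {R : realType} {n : nat}.
Variables (c : 'rV[R]_n) (eta : R).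
Local Notation ST := ('rV[R]_n * R)%type.

(** The power of the point x with respect to the sphere, up to sign.  Near the
    sphere it is comparable to the distance to the sphere, and it is smooth at
    the centre, which the distance is not. *)
Definition depth (x : 'rV[R]_n) : R := eta ^+ 2 - \sum_i (x 0 i - c 0 i) ^+ 2.

Lemma depthE x : depth x = eta ^+ 2 - enorm (x - c) ^+ 2.
Proof.
by rewrite enorm_sqr /depth; congr (_ - _); apply: eq_bigr => i _; rewrite !mxE.
Qed.

Lemma eball_depth x : 0 < eta -> eball c eta x <-> 0 < depth x.
Proof.
move=> eta0; rewrite depthE subr_gt0 /eball /=.
by rewrite ltr_sqr ?nnegrE ?enorm_ge0 ?ltW.
Qed.

Lemma continuous_coord (i : 'I_n) : continuous (fun x : 'rV[R]_n => x 0 i).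
Proof. exact: coord_continuous. Qed.

Lemma is_derive_depth_comp {V : normedModType R} (f : V -> 'rV[R]_n) (z v : V)
    (df : 'rV[R]_n) : (forall i, is_derive z v (fun y => f y 0 i) (df 0 i)) ->
  is_derive z v (depth \o f) (- (2 * \sum_i (f z 0 i - c 0 i) * df 0 i)).
Proof.
move=> fd.
have sqd i : is_derive z v (fun y => (f y 0 i - c 0 i) ^+ 2)
    (2 * ((f z 0 i - c 0 i) * df 0 i)).
  have d1 : is_derive z v (fun y => f y 0 i - c 0 i) (df 0 i).
    by rewrite -[df 0 i]subr0; exact: (is_deriveB (fd i) (is_derive_cst _ _ _)).
  have -> : (fun y => (f y 0 i - c 0 i) ^+ 2) =
      (fun y => f y 0 i - c 0 i) * (fun y => f y 0 i - c 0 i).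
    by apply/funext => y; rewrite expr2.
  have d2 := is_deriveM d1 d1; apply: is_derive_eq d2 _.
  by rewrite /GRing.scale /= mulr_natl mulr2n.
have -> : depth \o f = cst (eta ^+ 2) - \sum_i (fun y => (f y 0 i - c 0 i) ^+ 2).
  by apply/funext => y; rewrite /depth /= fctE fct_sumE.
have dB := is_deriveB (is_derive_cst (eta ^+ 2) z v) (is_derive_sum sqd).
apply: is_derive_eq dB _.
by rewrite sub0r mulr_sumr.
Qed.

Lemma is_derive_coord (x w : 'rV[R]_n) (i : 'I_n) :
  is_derive x w (fun y : 'rV[R]_n => y 0 i) (w 0 i).
Proof.
apply: (@is_derive_linear _ _ (fun y : 'rV[R]_n => y 0 i)) => k y.
by rewrite !mxE.
Qed.

Lemma is_derive_fst_coord (z v : ST) (i : 'I_n) :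
  is_derive z v (fun y : ST => y.1 0 i) (v.1 0 i).
Proof.
apply: (@is_derive_linear _ _ (fun y : ST => y.1 0 i)) => k y.
by rewrite !mxE.
Qed.

Lemma is_derive_snd (z v : ST) : is_derive z v (fun y : ST => y.2) v.2.
Proof. exact: (@is_derive_linear _ _ (fun y : ST => y.2)). Qed.

Lemma Ck_snd k (U : set ST) : open U -> Ck k U (fun y : ST => y.2).
Proof.
move=> Uo; apply: Ck_linear => //.
by move=> z; exact: cvg_snd.
Qed.

Lemma Ck_depth_comp {V : normedModType R} k (U : set V) (f : V -> 'rV[R]_n) :
  open U -> (forall i, continuous (fun y => f y 0 i)) ->
  (forall a x y, f (a *: x + y) = a *: f x + f y) ->
  Ck k U (fun y => depth (f y)).
Proof.
move=> Uo fc flin; apply: CkB => //; first exact: Ck_cst.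
apply: Ck_sum => // i.
have Ci : Ck k U (fun y => f y 0 i - c 0 i).
  apply: CkB; [exact: Uo| |exact: Ck_cst].
  by apply: Ck_linear => // a x y; rewrite flin !mxE.
rewrite (_ : (fun x => _) =
  (fun y => (f y 0 i - c 0 i) * (f y 0 i - c 0 i))); last first.
  by apply/funext => y; rewrite expr2.
exact: CkM.
Qed.

Lemma Ck_depth_fst k (U : set ST) : open U ->
  Ck k U (fun y : ST => depth y.1).
Proof.
move=> Uo; apply: Ck_depth_comp => // i z.
apply: (@continuous_comp _ _ _ fst (fun x : 'rV[R]_n => x 0 i)).
  exact: cvg_fst.
exact: continuous_coord.
Qed.

Lemma depth_continuous : continuous depth.
Proof.
have [dc _] := Ck_depth_comp 0 setT id openT continuous_coord
  (fun _ _ _ => erefl).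
by move=> x; exact: dc.
Qed.

End depth.

(** * The operator on functions of depth and time *)

Section radial_pde.
Context {R : realType} {n : nat}.
Variables (c : 'rV[R]_n) (U : set ('rV[R]_n * R)).
Variables (F G H : 'rV[R]_n * R -> R).

Let ds (x w : 'rV[R]_n) := - (2 * \sum_i (x 0 i - c 0 i) * w 0 i).

Hypothesis Uopen : open U.
Hypothesis dF : forall z w, U z -> is_derive z (w, 0) F (G z * ds z.1 w).
Hypothesis dG : forall z w, U z -> is_derive z (w, 0) G (H z * ds z.1 w).

Let ds_delta x i : ds x (delta_mx 0 i) = - (2 * (x - c) 0 i).
Proof.
rewrite /ds (bigD1 i) //= big1 ?addr0 => [|j ji].
  by rewrite !mxE !eqxx mulr1.
by rewrite !mxE eqxx (negPf ji) mulr0.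
Qed.

Lemma space_deriv_radial i z : U z ->
  space_deriv i F z = G z * - (2 * (z.1 - c) 0 i).
Proof.
by move=> Uz; have [_] := dF _ (delta_mx 0 i) Uz; rewrite ds_delta.
Qed.

Lemma space_grad_radial z : U z -> space_grad F z = - (2 * G z) *: (z.1 - c).
Proof.
by move=> Uz; apply/rowP => i; rewrite !mxE space_deriv_radial // !mxE; ring.
Qed.

(** F is a function of the depth s and of time, with first and second
    s-derivatives G and H; the gradient of s is - 2 (x - c) and its Hessian is
    - 2 times the identity. *)
Lemma space_hess_radial z : U z -> space_hess F z =
  - ((2 * G z)%:M + (- (4 * H z)) *: ((z.1 - c)^T *m (z.1 - c))).
Proof.
move=> Uz; apply/matrixP => i j; rewrite mxE {1}/space_deriv.
have <- := derive_eq_on Uopen (fun y => G y * - (2 * (y.1 - c) 0 j))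
  (space_deriv j F) (delta_mx 0 i, 0) z _ Uz.
  have dc : is_derive z (delta_mx 0 i, 0)
      (fun y : 'rV[R]_n * R => - (2 * (y.1 - c) 0 j)) (- (2 * (i == j)%:R)).
    have -> : (fun y : 'rV[R]_n * R => - (2 * (y.1 - c) 0 j)) =
        (fun u => -2 * u) \o
        ((fun y : 'rV[R]_n * R => y.1 0 j) - cst (c 0 j)).
      by apply/funext => y; rewrite /= !fctE !mxE mulNr.
    have d1 := is_deriveB (is_derive_fst_coord z (delta_mx 0 i, 0) j)
      (is_derive_cst (c 0 j) z (delta_mx 0 i, 0)).
    have d2 : is_derive (((fun y : 'rV[R]_n * R => y.1 0 j) - cst (c 0 j)) z) 1
        (fun u : R => -2 * u) (-2).
      rewrite -[X in is_derive _ _ _ X]mulr1.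
      apply: (@is_derive_linear _ _ (fun u : R => -2 * u)) => k u.
      by rewrite /GRing.scale /=; ring.
    apply: is_derive_eq (is_derive_comp1 _ _ _ _ _ _ d1 d2) _.
    by rewrite subr0 /= mxE eqxx /= mulNr eq_sym.
  have [_ ->] := is_deriveM (dG _ (delta_mx 0 i) Uz) dc.
  rewrite ds_delta /GRing.scale /= !mxE big_ord1 !mxE.
  by case: eqP => ij; rewrite ?mulr1n ?mulr0n; ring.
by move=> y /set_mem Uy; rewrite space_deriv_radial.
Qed.

Lemma pde_op_radial_le lam Lam p z :
  lam <= Lam -> U z -> 0 <= G z -> H z <= 0 ->
  pde_op lam Lam p F z <=
  time_deriv F z
  + Lam * (n%:R * (2 * G z) + (- (4 * H z)) * enorm (z.1 - c) ^+ 2)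
  - (2 * G z * enorm (z.1 - c)) `^ p.
Proof.
move=> lL Uz G0 H0; rewrite /pde_op space_hess_radial // space_grad_radial //.
rewrite enormZ normrN ger0_norm ?mulr_ge0//.
rewrite lerD2r lerD2l lerNl.
by apply: pucci_min_ge => //; [rewrite mulr_ge0|rewrite oppr_ge0 mulr_ge0_le0].
Qed.

End radial_pde.

(** * Comparison with strict subsolutions *)

Lemma derive_addr {R : realType} {V : normedModType R} (f : V -> R) (k : R) :
  (fun v : V => 'D_v (fun y => f y + k)) = (fun v => 'D_v f).
Proof.
apply/funext => v; apply/funext => x; rewrite /derive.
set f1 := (fun h : R => _); set f2 := (fun h : R => _).
suff -> : f1 = f2 by [].
by apply/funext => h; rewrite /f1 /f2 /= [f x + k]addrC addrKA.
Qed.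

Lemma pde_op_addr {R : realType} {n : nat} (lam Lam p k : R)
    (phi : 'rV[R]_n * R -> R) z :
  pde_op lam Lam p (fun y => phi y + k) z = pde_op lam Lam p phi z.
Proof.
have Dk v : 'D_v (fun y => phi y + k) = 'D_v phi.
  exact: (congr1 (fun g => g v) (derive_addr phi k)).
have sD i : space_deriv i (fun y => phi y + k) = space_deriv i phi.
  exact: (Dk (delta_mx 0 i, 0)).
have tD : time_deriv (fun y => phi y + k) z = time_deriv phi z.
  exact: (congr1 (fun g => g z) (Dk (0, 1))).
have hD : space_hess (fun y => phi y + k) z = space_hess phi z.
  by apply: eq_mx => i j; rewrite (sD j).
have gD : space_grad (fun y => phi y + k) z = space_grad phi z.
  by apply/rowP => i; rewrite !mxE !sD.
by rewrite /pde_op tD hD gD.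
Qed.

(** Outside K one has phi < m <= u, so a negative minimum of u - phi over K is
    a minimum over all of W at nonnegative times; it is attained at a positive
    time, and the translate of phi through that point touches u from below. *)
Lemma strict_subsolution_le {R : realType} {n : nat} (lam Lam p m : R)
    (Omega : set 'rV[R]_n) (u : 'rV[R]_n * R -> R)
    (W : set ('rV[R]_n * R)) (phi : 'rV[R]_n * R -> R) :
  {within closure Omega `*` [set t : R | 0 <= t], continuous u} ->
  viscosity_solution lam Lam p Omega u ->
  open W -> (forall z, W z -> Omega z.1) ->
  (forall k, Ck k W phi) ->
  (forall z, W z -> 0 < z.2 -> pde_op lam Lam p phi z < 0) ->
  (forall z, W z -> 0 <= z.2 -> m <= u z) ->
  (exists K, [/\ compact K, K `<=` W `&` [set z | 0 <= z.2]
     & forall z, W z -> 0 <= z.2 -> m <= phi z -> K z]) ->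
  (forall z, W z -> z.2 = 0 -> phi z <= u z) ->
  forall z, W z -> 0 <= z.2 -> phi z <= u z.
Proof.
move=> uc uvisc Wo WO phiC phi_lt um [K [Kc KW phiK]] phi0 z Wz z0.
rewrite leNgt; apply/negP => uphi.
have Kz : K z by apply: phiK => //; apply: le_trans (um _ Wz z0) (ltW uphi).
have fc : {within K, continuous (fun y => u y - phi y)}.
  move=> y; apply: continuousB.
    apply: continuous_subspaceW uc _ => w Kw; have [Ww w0] := KW w Kw.
    by split => //=; apply: subset_closure; exact: WO.
  move: y; apply/subspace_continuousP => w Kw; apply: cvg_within_filter.
  by have [phic _] := phiC 0; apply: phic; exact: (KW w Kw).1.
have [z1 /set_mem Kz1 z1min] := compact_EVT_min (ex_intro _ z Kz) Kc fc.
have [Wz1 /= z1ge0] := KW _ Kz1.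
have fz1 : u z1 - phi z1 < 0.
  by apply: le_lt_trans (z1min _ (mem_set Kz)) _; rewrite subr_lt0.
have min_z1 y : W y -> 0 <= y.2 -> u z1 - phi z1 <= u y - phi y.
  move=> Wy y0; have [my|ym] := leP m (phi y).
    by apply: z1min; apply/mem_set; exact: phiK.
  apply/ltW; apply: lt_le_trans fz1 _; rewrite subr_ge0.
  exact: le_trans (ltW ym) (um _ Wy y0).
have z1gt0 : 0 < z1.2.
  rewrite lt_neqAle z1ge0 andbT; apply/eqP => z10.
  by move: fz1; rewrite ltNge subr_ge0 phi0.
pose psi y := phi y + (u z1 - phi z1).
have psi_touch : touches_below (Omega `*` [set t : R | 0 < t]) u psi z1.
  split.
  - exists W; split => // k.
    by apply: CkD => //; exact: Ck_cst.
  - by rewrite /psi subrKC.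
  - near=> y => -[_ /= y0]; rewrite /psi -lerBrDl; apply: min_z1.
      by near: y; exact: open_nbhs_nbhs.
    exact: ltW.
have [_ /(_ psi psi_touch)] := uvisc z1 (conj (WO _ Wz1) z1gt0).
by rewrite pde_op_addr leNgt phi_lt.
Unshelve. all: by end_near. Qed.

(** * The differential inequality *)

Lemma powR_subr1 {R : realType} (s r : R) : 0 < s -> s `^ (r - 1) = s `^ r / s.
Proof.
by move=> s0; rewrite powRB ?powRr1 ?ltW //; apply/implyP => _; rewrite gt_eqF.
Qed.

(** The differential inequality of the barrier reduced to numbers: G and H are
    its first and second derivatives in the depth s, and r = |x - c|.  For
    r >= eta / 2, half of (2 G r)^p absorbs the second-order terms thanks to
    G >= D s^q with q (p - 1) = - 1, and the other half absorbs b eta^2.  For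
    r <= eta / 2, the depth is at least 3/4 eta^2, so G <= 2 a0: then - b s
    absorbs 3/4 b eta^2 and - 2 E a0 absorbs the second-order terms. *)
Lemma radial_subsolution_ineq {R : realType}
    (p Lam N eta a0 b D eps E q a s r G H : R) :
  2 < p -> 0 < Lam -> 0 <= N -> 0 < eta -> 0 < a0 -> 0 <= b -> 0 <= D ->
  0 <= eps -> E = Lam * (2 * N + 8) -> q = - (p - 1)^-1 ->
  (D * eta) `^ (p - 1) = 2 * E * eta ->
  2 * b * eta ^+ 2 <= (a0 / 2 * eta) `^ p ->
  D * (3 / 4 * eta ^+ 2) `^ q <= a0 / 2 ->
  eps <= a0 / 2 * (3 / 4 * eta ^+ 2) ^+ 2 ->
  a0 / 2 <= a <= a0 -> 0 <= r -> s = eta ^+ 2 - r ^+ 2 -> 0 < s ->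
  G = a + D * s `^ q + eps / s ^+ 2 ->
  - H <= 2 * G / s -> H <= 0 ->
  3 / 4 * b * eta ^+ 2 - 2 * E * a0 - b * s
    + Lam * (N * (2 * G) + - (4 * H) * r ^+ 2) <= (2 * G * r) `^ p.
Proof.
move=> hp hLam hN heta ha0 hb hD heps EE qE hDeta hba0 hDs heps_small.
move=> /andP[aL aU] r0 sE s0 GE HG H0.
have a_gt0 : 0 < a by lra.
have sq0 : 0 <= s `^ q by exact: powR_ge0.
have e0 : 0 <= eps / s ^+ 2 by rewrite divr_ge0 ?sqr_ge0.
have Ga : a <= G by rewrite GE -addrA lerDl addr_ge0 // mulr_ge0.
have GD : D * s `^ q <= G by rewrite GE addrAC lerDr addr_ge0 // ltW.
have G0 : 0 <= G by lra.
have E0 : 0 < E by rewrite EE; apply: mulr_gt0 => //; lra.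
have [Gs GsE] : exists Gs, Gs = G / s by eexists.
have GGs : G = Gs * s by rewrite GsE divfK // gt_eqF.
have Gs0 : 0 <= Gs by rewrite GsE divr_ge0 // ltW.
have HGs : - H <= 2 * Gs by rewrite GsE mulrA.
have r20 := sqr_ge0 r.
have S1 : Lam * (N * (2 * G) + - (4 * H) * r ^+ 2) <=
    Lam * (Gs * (2 * N * s + 8 * r ^+ 2)).
  rewrite ler_pM2l // GGs.
  have : - H * r ^+ 2 <= 2 * Gs * r ^+ 2 by exact: ler_wpM2r.
  lra.
have [rs|rs] := leP eta (2 * r).
- have S2 : Lam * (Gs * (2 * N * s + 8 * r ^+ 2)) <= E * eta ^+ 2 * Gs.
    have -> : E * eta ^+ 2 * Gs = Lam * (Gs * ((2 * N + 8) * eta ^+ 2)).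
      by rewrite EE; ring.
    rewrite ler_pM2l // ler_wpM2l //.
    have : N * s <= N * eta ^+ 2 by apply: ler_wpM2l => //; lra.
    have : r ^+ 2 <= eta ^+ 2 by lra.
    lra.
  have Ge0 : 0 <= G * eta by rewrite mulr_ge0 // ltW.
  have Gp_grad : (G * eta) `^ p <= (2 * G * r) `^ p.
    have -> : 2 * G * r = G * (2 * r) by ring.
    apply: ge0_ler_powR; rewrite ?nnegrE //; first lra.
      by rewrite !mulr_ge0.
    exact: ler_wpM2l.
  have Gp_second : 2 * E * eta ^+ 2 * Gs <= (G * eta) `^ p.
    rewrite -mulr_powRB1 //; last lra.
    have h1 : (D * s `^ q * eta) `^ (p - 1) = 2 * E * eta / s.
      rewrite mulrAC powRM ?mulr_ge0 ?(ltW heta)// hDeta.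
      rewrite -powRrM qE mulNr mulVf ?powR_inv1 ?ltW//.
      by rewrite gt_eqF // subr_gt0; lra.
    have h2 : 2 * E * eta / s <= (G * eta) `^ (p - 1).
      rewrite -h1; apply: ge0_ler_powR; rewrite ?nnegrE ?mulr_ge0 ?(ltW heta)//.
        by rewrite subr_ge0; lra.
      by rewrite ler_wpM2r // ltW.
    apply: le_trans (ler_wpM2l Ge0 h2).
    by rewrite le_eqVlt; apply/orP; left; apply/eqP; rewrite GsE; ring.
  have Gp_time : 2 * b * eta ^+ 2 <= (G * eta) `^ p.
    apply: le_trans hba0 _; apply: ge0_ler_powR; rewrite ?nnegrE //; first lra.
      by rewrite mulr_ge0 ?(ltW heta)//; lra.
    by rewrite ler_pM2r //; lra.
  have bs : 0 <= b * s by rewrite mulr_ge0 // ltW.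
  have Ea : 0 <= E * a0 by rewrite mulr_ge0 // ltW.
  have be : 0 <= b * eta ^+ 2 by rewrite mulr_ge0 // sqr_ge0.
  have := powR_ge0 (2 * G * r) p.
  lra.
- have r2 : 4 * r ^+ 2 <= eta ^+ 2.
    have : (2 * r) ^+ 2 <= eta ^+ 2 by rewrite ler_sqr ?nnegrE ?mulr_ge0// ltW.
    by rewrite exprMn; lra.
  have [s1 s1E] : exists s1, s1 = 3 / 4 * eta ^+ 2 by eexists.
  have s1s : s1 <= s by rewrite s1E; lra.
  have s10 : 0 < s1 by rewrite s1E mulr_gt0 ?exprn_gt0.
  have sq1 : s `^ q <= s1 `^ q.
    rewrite qE !powRN lef_pV2 ?posrE ?powR_gt0//.
    apply: ge0_ler_powR; rewrite ?nnegrE ?(ltW s0) ?(ltW s10)//.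
    by rewrite invr_ge0; lra.
  have D1 : D * s `^ q <= a0 / 2.
    by apply: le_trans hDs; rewrite -s1E; exact: ler_wpM2l.
  have e1 : eps / s ^+ 2 <= a0 / 2.
    rewrite ler_pdivrMr ?exprn_gt0//; apply: le_trans heps_small _.
    rewrite -s1E.
    apply: ler_wpM2l; first by rewrite divr_ge0 // ltW.
    by rewrite ler_sqr ?nnegrE ?(ltW s0) ?(ltW s10).
  have G2 : G <= 2 * a0 by lra.
  have S2 : Lam * (Gs * (2 * N * s + 8 * r ^+ 2)) <= E * G.
    have -> : E * G = Lam * (Gs * ((2 * N + 8) * s)) by rewrite EE GGs; ring.
    rewrite ler_pM2l // ler_wpM2l //.
    rewrite s1E in s1s; lra.
  have S3 : E * G <= E * (2 * a0) by rewrite ler_pM2l.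
  have bs : b * s1 <= b * s by rewrite ler_wpM2l.
  have := powR_ge0 (2 * G * r) p.
  rewrite s1E in bs; lra.
Qed.

(** * The barrier *)

Section barrier.
Context {R : realType} {n : nat}.
Variables (c : 'rV[R]_n) (eta m0 m1 a0 b C be eps tau : R).
Local Notation ST := ('rV[R]_n * R)%type.
Local Notation s := (fun z : ST => depth c eta z.1).

Definition cylinder : set ST := [set z | 0 < s z /\ z.2 < tau].

(** Apart from the eps-terms, m0 - m1 t is the value on the sphere; it increases
    when m1 < 0, while the paraboloid (a0 - b t) s flattens so that the value at
    the centre decreases.  The term C s^be has infinite slope at the sphere, and
    the two eps-terms push the function to -oo at the edge of the cylinder. *)
Definition barrier (z : ST) : R :=
  (m0 - m1 * z.2) + (a0 - b * z.2) * s z + C * s z `^ be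
  - eps * s z `^ (- 1) - eps * (tau - z.2) `^ (- 1).

(** The derivative of [barrier] with respect to the depth s. *)
Definition barrier_slope (z : ST) : R :=
  (a0 - b * z.2) + C * (be * s z `^ (be - 1)) + eps * s z `^ (- 1 - 1).

(** The second derivative of [barrier] with respect to the depth s. *)
Definition barrier_curv (z : ST) : R :=
  C * (be * ((be - 1) * s z `^ (be - 1 - 1)))
  - eps * (2 * s z `^ (- 1 - 1 - 1)).

Lemma depth_fst_continuous : continuous s.
Proof.
move=> z; apply: (@continuous_comp _ _ _ fst (depth c eta)); first exact: cvg_fst.
exact: depth_continuous.
Qed.

Lemma cylinder_open : open cylinder.
Proof.
apply: openI.
  apply: (@open_comp _ _ s [set y | 0 < y]); last exact: open_gt.
  by move=> z _; exact: depth_fst_continuous.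
apply: (@open_comp _ _ snd [set y | y < tau]); last exact: open_lt.
by move=> z _; exact: cvg_snd.
Qed.

Lemma barrier_smooth k : Ck k cylinder barrier.
Proof.
have Wo := cylinder_open.
have Cc (x : R) : Ck k cylinder (fun=> x) by exact: Ck_cst.
have Cs : Ck k cylinder s by exact: Ck_depth_fst.
have Ct : Ck k cylinder snd by exact: Ck_snd.
have Csr r : Ck k cylinder (fun z => s z `^ r).
  by apply: Ck_powR => // z [].
apply: CkB => //; last first.
  apply: CkM => //; apply: Ck_powR => //; last exact: CkB.
  by move=> z [_ tz]; rewrite subr_gt0.
apply: CkB => //; last exact: CkM.
apply: CkD => //; last exact: CkM.
apply: CkD => //; first by apply: CkB => //; exact: CkM.
by apply: CkM => //; apply: CkB => //; exact: CkM.
Qed.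

Lemma is_derive_cstM (k : R) (f : ST -> R) z v df : is_derive z v f df ->
  is_derive z v (fun y => k * f y) (k * df).
Proof. by move=> fd; exact: is_deriveZ. Qed.

Lemma is_derive_affine_snd (k0 k1 : R) (z v : ST) :
  is_derive z v (fun y : ST => k0 - k1 * y.2) (- (k1 * v.2)).
Proof.
have d1 : is_derive z v (fun y : ST => k1 * y.2) (k1 * v.2).
  by apply: is_derive_cstM; exact: is_derive_snd.
have d2 := is_deriveB (is_derive_cst k0 z v) d1.
by apply: is_derive_eq d2 _; rewrite sub0r.
Qed.

Lemma is_derive_depth_fst (z v : ST) :
  is_derive z v s (- (2 * \sum_i (z.1 0 i - c 0 i) * v.1 0 i)).
Proof.
apply: (@is_derive_depth_comp _ _ c eta _ (fst : ST -> 'rV[R]_n)) => i.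
exact: is_derive_fst_coord.
Qed.

Lemma is_derive_barrier z v ds : cylinder z -> is_derive z v s ds ->
  is_derive z v barrier
    (v.2 * (- m1 - b * s z - eps * (tau - z.2) `^ (- 1 - 1))
     + barrier_slope z * ds).
Proof.
move=> [sz tz] sd.
have d1 := is_derive_affine_snd m0 m1 z v.
have d2 := is_deriveM (is_derive_affine_snd a0 b z v) sd.
have dpow r := is_derive_powRf s r z v ds sz sd.
have d3 := is_derive_cstM C _ _ _ _ (dpow be).
have d4 := is_derive_cstM eps _ _ _ _ (dpow (- 1)).
have dt : is_derive z v (fun y : ST => tau - y.2) (- v.2).
  have := is_deriveB (is_derive_cst tau z v) (is_derive_snd z v).
  by rewrite sub0r.
have tz' : 0 < tau - z.2 by rewrite subr_gt0.
have d5 := is_derive_cstM eps _ _ _ _ (is_derive_powRf _ (- 1) z v (- v.2) tz' dt).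
have d := is_deriveB (is_deriveB (is_deriveD (is_deriveD d1 d2) d3) d4) d5.
apply: is_derive_eq d _.
by rewrite /barrier_slope /GRing.scale /=; ring.
Qed.

Lemma is_derive_barrier_slope z v ds : cylinder z -> v.2 = 0 ->
  is_derive z v s ds ->
  is_derive z v barrier_slope (barrier_curv z * ds).
Proof.
move=> [sz tz] v0 sd.
have d1 := is_derive_affine_snd a0 b z v.
have dpow r := is_derive_powRf s r z v ds sz sd.
have d2 := is_derive_cstM C _ _ _ _ (is_derive_cstM be _ _ _ _ (dpow (be - 1))).
have d3 := is_derive_cstM eps _ _ _ _ (dpow (- 1 - 1)).
have d := is_deriveD (is_deriveD d1 d2) d3.
apply: is_derive_eq d _.
by rewrite v0 /barrier_curv /=; ring.
Qed.

Lemma pde_op_barrier_le lam Lam p z : lam <= Lam -> cylinder z ->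
  0 <= barrier_slope z -> barrier_curv z <= 0 ->
  pde_op lam Lam p barrier z <=
  (- m1 - b * s z - eps * (tau - z.2) `^ (- 1 - 1))
  + Lam * (n%:R * (2 * barrier_slope z)
           + (- (4 * barrier_curv z)) * enorm (z.1 - c) ^+ 2)
  - (2 * barrier_slope z * enorm (z.1 - c)) `^ p.
Proof.
move=> lL Wz G0 H0.
have tE : time_deriv barrier z =
    - m1 - b * s z - eps * (tau - z.2) `^ (- 1 - 1).
  have [_ dE] :=
    is_derive_barrier z (0, 1) _ Wz (is_derive_depth_fst z (0, 1)).
  apply: etrans dE _; rewrite /= mul1r big1 => [|i _]; last by rewrite mxE mulr0.
  by rewrite mulr0 oppr0 mulr0 addr0.
rewrite -tE; apply: (pde_op_radial_le c cylinder) => //.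
- exact: cylinder_open.
- move=> y w Wy.
  have := is_derive_barrier y (w, 0) _ Wy (is_derive_depth_fst _ _).
  by rewrite /= mul0r add0r.
- move=> y w Wy.
  exact: is_derive_barrier_slope (is_derive_depth_fst y (w, 0)).
Qed.

End barrier.

Lemma depth_le {R : realType} {n : nat} (c : 'rV[R]_n) (eta : R) x :
  depth c eta x <= eta ^+ 2.
Proof. by rewrite depthE gerBl sqr_ge0. Qed.

Lemma bounded_set_sub {R : realType} {V : normedModType R} (A B : set V) :
  A `<=` B -> bounded_set B -> bounded_set A.
Proof. by move=> AB [M [Mr BM]]; exists M; split => // y /BM BM' x /AB /BM'. Qed.

Lemma depth_superlevel_compact {R : realType} {n : nat} (c : 'rV[R]_n)
    (eta d : R) : 0 < eta -> bounded_set (eball c eta) -> 0 < d ->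
  compact [set x | d <= depth c eta x].
Proof.
move=> eta0 Bb d0; apply: bounded_closed_compact.
  apply: bounded_set_sub Bb => x /= dx; apply/eball_depth => //.
  exact: lt_le_trans dx.
apply: (@closed_comp _ _ (depth c eta) [set y | d <= y]); last exact: closed_ge.
by move=> x _; exact: depth_continuous.
Qed.

(** All terms of the barrier other than the two eps-terms are bounded, so where
    it is at least m both the depth and the remaining time are at least some
    d > 0. *)
Lemma barrier_superlevel_compact {R : realType} {n : nat} (c : 'rV[R]_n)
    (eta m0 m1 a0 b C be eps tau m : R) :
  0 < eta -> bounded_set (eball c eta) ->
  0 <= a0 -> 0 <= b -> 0 <= C -> 0 <= be -> 0 < eps -> 0 < tau ->
  exists K, [/\ compact K,
    K `<=` cylinder c eta tau `&` [set z | 0 <= z.2]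
    & forall z, cylinder c eta tau z -> 0 <= z.2 ->
        m <= barrier c eta m0 m1 a0 b C be eps tau z -> K z].
Proof.
move=> eta0 Bb a00 b0 C0 be0 eps0 tau0.
pose A := `|m0| + `|m1| * tau + a0 * eta ^+ 2 + C * (eta ^+ 2) `^ be.
pose A1 := `|A - m| + 1.
have A10 : 0 < A1 by rewrite ltr_wpDl.
pose d := eps / A1.
have d0 : 0 < d by rewrite divr_gt0.
exists ([set x | d <= depth c eta x] `*` `[0, tau - d]%classic); split.
- apply: compact_setX; last exact: segment_compact.
  exact: depth_superlevel_compact.
- move=> z [/= zd]; rewrite in_itv /= => /andP[z0 zt]; split => //; split.
    exact: lt_le_trans zd.
  by apply: le_lt_trans zt _; rewrite ltrBlDr ltrDl.
move=> z [sz tz] z0 mz.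
have sle := depth_le c eta z.1.
have tz0 : 0 < tau - z.2 by rewrite subr_gt0.
have B1 : m0 <= `|m0| by exact: ler_norm.
have B2 : - (m1 * z.2) <= `|m1| * tau.
  apply: le_trans (ler_norm _) _; rewrite normrN normrM ler_wpM2l //.
  by rewrite ger0_norm // ltW.
have B3 : (a0 - b * z.2) * depth c eta z.1 <= a0 * eta ^+ 2.
  apply: le_trans (ler_wpM2l a00 sle); rewrite ler_wpM2r ?(ltW sz)//.
  by rewrite gerBl mulr_ge0.
have B4 : C * depth c eta z.1 `^ be <= C * (eta ^+ 2) `^ be.
  apply: ler_wpM2l => //; apply: ge0_ler_powR => //; rewrite nnegrE.
    exact: ltW.
  exact: sqr_ge0.
have Am : A - m <= `|A - m| by exact: ler_norm.
have inv_le (r : R) : 0 < r -> eps * r^-1 < A1 -> d <= r.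
  move=> r0 h; rewrite /d ler_pdivrMr // mulrC -ler_pdivrMr //.
  exact: ltW.
have s1 : 0 <= eps * (depth c eta z.1)^-1 by rewrite mulr_ge0 ?invr_ge0// ltW.
have s2 : 0 <= eps * (tau - z.2)^-1 by rewrite mulr_ge0 ?invr_ge0// ltW.
move: mz; rewrite /barrier !powR_inv1 ?(ltW sz) ?(ltW tz0)// => mz.
have mA : eps * (depth c eta z.1)^-1 + eps * (tau - z.2)^-1 < A1.
  rewrite /A1; apply: le_lt_trans (_ : A - m < _); last first.
    by rewrite (le_lt_trans Am)// ltrDl.
  rewrite /A; move: B1 B2 B3 B4 mz.
  move: (`|m0|) (`|m1| * tau) (a0 * _) (C * (eta ^+ 2) `^ be) (C * _)
    (_ * depth _ _ _).
  move: (eps * _) (eps * _) (m1 * _) => *; lra.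
split => /=; first by apply: inv_le => //; apply: le_lt_trans mA; rewrite lerDl.
rewrite in_itv /= z0 lerBrDr -lerBrDl.
by apply: inv_le => //; apply: le_lt_trans mA; rewrite lerDr.
Qed.

(** The coefficient of t in the barrier is such that its time derivative
    consists of the terms of [radial_subsolution_ineq] other than the
    second-order ones, minus eps / (tau - t)^2, which makes the inequality
    strict. *)
Lemma barrier_strict_subsolution {R : realType} {n : nat} (c : 'rV[R]_n)
    (p lam Lam eta m0 a0 b C be eps tau E : R) z :
  2 < p -> lam <= Lam -> 0 < Lam -> 0 < eta -> 0 < a0 -> 0 <= b -> 0 <= C ->
  0 < eps -> be = 1 - (p - 1)^-1 -> E = Lam * (2 * n%:R + 8) ->
  (C * be * eta) `^ (p - 1) = 2 * E * eta ->
  2 * b * eta ^+ 2 <= (a0 / 2 * eta) `^ p ->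
  C * be * (3 / 4 * eta ^+ 2) `^ (be - 1) <= a0 / 2 ->
  eps <= a0 / 2 * (3 / 4 * eta ^+ 2) ^+ 2 ->
  b * tau = a0 / 2 ->
  cylinder c eta tau z -> 0 < z.2 ->
  pde_op lam Lam p
    (barrier c eta m0 (2 * E * a0 - 3 / 4 * b * eta ^+ 2) a0 b C be eps tau) z
  < 0.
Proof.
move=> hp lL hLam eta0 a00 b0 C0 eps0 beE EE hD hb hq heps btau Wz z0.
have [sz tz] := Wz.
have q0 : 0 < (p - 1)^-1 by rewrite invr_gt0; lra.
have q1 : (p - 1)^-1 < 1 by rewrite invf_lt1; lra.
have be0 : 0 < be by lra.
have be1 : be - 1 = - (p - 1)^-1 by rewrite beE; ring.
have [G GE] : exists G, G = barrier_slope c eta a0 b C be eps z by eexists.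
have [H HE] : exists H, H = barrier_curv c eta C be eps z by eexists.
have [s sE] : exists s, s = depth c eta z.1 by eexists.
rewrite -sE in sz.
have GE' : G = (a0 - b * z.2) + C * be * s `^ (- (p - 1)^-1) + eps / s ^+ 2.
  rewrite GE /barrier_slope -sE be1 powR_subr1 // powR_inv1 ?ltW// -mulrA.
  by rewrite -invfM -expr2.
have HE' : - H = C * be * s `^ (- (p - 1)^-1) * (1 - be) / s
    + 2 * (eps / s ^+ 2) / s.
  rewrite HE /barrier_curv -sE be1 !(powR_subr1 s) // powR_inv1 ?ltW//.
  have -> : 1 - be = (p - 1)^-1 by rewrite beE; ring.
  move: (p - 1)^-1 => q; field; rewrite gt_eqF //.
have a_itv : a0 / 2 <= a0 - b * z.2 <= a0.
  have bz1 : b * z.2 <= a0 / 2 by rewrite -btau ler_wpM2l // ltW.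
  have bz0 : 0 <= b * z.2 by rewrite mulr_ge0 // ltW.
  by apply/andP; split; lra.
have [Q QE] : exists Q, Q = C * be * s `^ (- (p - 1)^-1) by eexists.
have Q0 : 0 <= Q by rewrite QE !mulr_ge0 ?powR_ge0// ltW.
have [e2 e2E] : exists e2, e2 = eps / s ^+ 2 by eexists.
have e20 : 0 <= e2 by rewrite e2E divr_ge0 ?sqr_ge0 ?ltW.
have G0 : 0 <= G.
  by rewrite GE' -QE -e2E; case/andP: a_itv => *; lra.
have H0 : H <= 0.
  rewrite -oppr_ge0 HE' -QE -e2E.
  apply: addr_ge0; apply: divr_ge0; rewrite ?(ltW sz)//; apply: mulr_ge0 => //.
  lra.
have HG : - H <= 2 * G / s.
  rewrite HE' GE' -QE -e2E -mulrDl ler_pM2r ?invr_gt0//.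
  have Qb : Q * (1 - be) <= Q by rewrite ler_piMr //; lra.
  case/andP: a_itv => aL aU; lra.
apply: le_lt_trans (pde_op_barrier_le _ _ _ _ _ _ _ _ _ _ lam Lam p z lL Wz _ _) _.
- by rewrite -GE.
- by rewrite -HE.
rewrite -GE -HE -sE.
have core := radial_subsolution_ineq p Lam n%:R eta a0 b (C * be) eps E
  (- (p - 1)^-1) (a0 - b * z.2) s (enorm (z.1 - c)) G H.
have {}core := core hp hLam (ler0n _ n) eta0 a00 b0 (mulr_ge0 C0 (ltW be0))
  (ltW eps0) EE erefl hD hb.
rewrite be1 in hq.
have {}core := core hq heps a_itv (enorm_ge0 _).
have sE' : s = eta ^+ 2 - enorm (z.1 - c) ^+ 2 by rewrite sE depthE.
have {}core := core sE' sz GE' HG H0.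
have e3 : 0 < eps * (tau - z.2) `^ (- 1 - 1).
  by rewrite mulr_gt0 ?powR_gt0 ?subr_gt0.
lra.
Qed.

(** * Growth in an interior ball *)

Lemma compact_closure_bounded {R : realType} {n : nat} (A : set 'rV[R]_n) :
  bounded_set A -> compact (closure A).
Proof.
move=> [M [Mr AM]]; apply: bounded_closed_compact; last exact: closed_closure.
exists M; split => // N MN x /= Ax.
have cN : closed [set y : 'rV[R]_n | `|y| <= N].
  apply: (@closed_comp _ _ (fun y : 'rV[R]_n => `|y|) [set y | y <= N]);
    last exact: closed_le.
  by move=> y _; exact: norm_continuous.
have AN : A `<=` [set y : 'rV[R]_n | `|y| <= N] by exact: AM.
by have := closure_subset AN Ax; rewrite -(closure_id _).1.
Qed.

Lemma bounded_below_cylinder {R : realType} {n : nat} (A : set 'rV[R]_n)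
    (u : 'rV[R]_n * R -> R) (tau : R) : bounded_set A -> 0 <= tau ->
  {within closure A `*` [set t : R | 0 <= t], continuous u} ->
  exists m, forall z, closure A z.1 -> 0 <= z.2 <= tau -> m <= u z.
Proof.
move=> Ab tau0 uc.
have [[x Ax]|/nonemptyPn A0] := pselect (closure A !=set0); last first.
  by exists 0 => z; rewrite A0.
have Kc : compact (closure A `*` `[0, tau]%classic).
  apply: compact_setX; last exact: segment_compact.
  exact: compact_closure_bounded.
have K0 : (closure A `*` `[0, tau]%classic) !=set0.
  by exists (x, 0); split => //=; rewrite in_itv /= lexx.
have uK : {within closure A `*` `[0, tau]%classic, continuous u}.
  apply: continuous_subspaceW uc => z [Az]; rewrite /= in_itv /= => /andP[z0 _].
  by split.
have [z1 _ min1] := compact_EVT_min K0 Kc uK.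
exists (u z1) => z Az zt; apply: min1; apply/mem_set; split => //=.
Qed.

(** The constants are chosen in this order: D, hence C, makes the gradient beat
    the second-order terms; T makes the loss at the centre small; a0 is then
    taken so large that the gradient beats the time derivative (A1), that the
    slope near the centre stays below 2 a0 (A2) and that C s^be stays below half
    of the initial deficit at the sphere (A3); finally eps is adapted to
    the point x, so that a failure of the bound at x contradicts comparison. *)
Lemma ball_growth {R : realType} (n : nat) (p lam Lam eta : R) :
  2 < p -> lam <= Lam -> 0 < Lam -> 0 < eta ->
  exists L T kappa : R, [/\ 0 <= L, 0 < T, 0 < kappa &
    forall (Omega : set 'rV[R]_n) (c : 'rV[R]_n) (u : 'rV[R]_n * R -> R),
      bounded_set Omega -> eball c eta `<=` Omega ->
      {within closure Omega `*` [set t : R | 0 <= t], continuous u} ->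
      viscosity_solution lam Lam p Omega u ->
      (forall x, eball c eta x -> L * depth c eta x ^+ 2 <= u (x, 0)) ->
      forall x, eball c eta x -> kappa <= u (x, T)].
Proof.
move=> hp lL hLam eta0.
have p1 : 0 < p - 1 by lra.
have [E EE] : exists E, E = Lam * (2 * n%:R + 8) by eexists.
have E0 : 0 < E by rewrite EE mulr_gt0 // ltr_wpDl // mulr_ge0.
have [be beE] : exists be, be = 1 - (p - 1)^-1 by eexists.
have be0 : 0 < be.
  by rewrite beE subr_gt0 invf_lt1 //; lra.
have [e2 e2E] : exists e2, e2 = eta ^+ 2 by eexists.
have e20 : 0 < e2 by rewrite e2E exprn_gt0.
have [D DE] : exists D, D = (2 * E * eta) `^ (p - 1)^-1 / eta by eexists.
have D0 : 0 < D by rewrite DE divr_gt0 // powR_gt0 // !mulr_gt0.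
have [C CE] : exists C, C = D / be by eexists.
have C0 : 0 < C by rewrite CE divr_gt0.
have Cbe : C * be = D by rewrite CE divfK // gt_eqF.
have powK (y : R) : 0 <= y -> (y `^ (p - 1)^-1) `^ (p - 1) = y.
  by move=> y0; rewrite -powRrM mulVf ?gt_eqF// powRr1.
have [A1 A1E] : exists A1, A1 = (64 * E / eta) `^ (p - 1)^-1 by eexists.
have A10 : 0 <= A1 by rewrite A1E powR_ge0.
have [A2 A2E] : exists A2, A2 = D * (3 / 4 * eta ^+ 2) `^ (be - 1) by eexists.
have A20 : 0 <= A2 by rewrite A2E mulr_ge0 ?powR_ge0 // ltW.
have [A3 A3E] : exists A3, A3 = C * (eta ^+ 2) `^ be by eexists.
have A30 : 0 <= A3 by rewrite A3E mulr_ge0 ?powR_ge0 // ltW.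
have [a0 a0E] : exists a0, a0 = 2 / eta * A1 + 2 * A2 + 16 * A3 / e2 + 1.
  by eexists.
have B1 : 0 <= 2 / eta * A1 by rewrite mulr_ge0 // divr_ge0 // ltW.
have B3 : 0 <= 16 * A3 / e2 by rewrite divr_ge0 ?mulr_ge0 // ltW.
have a0_gt0 : 0 < a0 by lra.
have a0A1 : A1 <= a0 / 2 * eta.
  have : 2 / eta * A1 <= a0 by lra.
  by rewrite mulrAC ler_pdivrMr //; lra.
have a0A2 : A2 <= a0 / 2 by lra.
have a0A3 : A3 <= a0 * e2 / 16.
  have : 16 * A3 / e2 <= a0 by lra.
  by rewrite ler_pdivrMr //; lra.
have [T TE] : exists T, T = e2 / (64 * E) by eexists.
have T0 : 0 < T by rewrite TE divr_gt0 // mulr_gt0.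
have ET : E * T = e2 / 64 by rewrite TE; field; rewrite gt_eqF.
have [b bE] : exists b, b = 16 * E * a0 / e2 by eexists.
have b0 : 0 < b by rewrite bE divr_gt0 // !mulr_gt0.
have be2 : b * e2 = 16 * E * a0 by rewrite bE divfK // gt_eqF.
have bT : b * T = a0 / 4.
  by rewrite bE TE; field; rewrite !gt_eqF.
have [m1 m1E] : exists m1, m1 = 2 * E * a0 - 3 / 4 * b * eta ^+ 2 by eexists.
have [kappa kE] : exists kappa, kappa = a0 * e2 / 32 by eexists.
have k0 : 0 < kappa by rewrite kE divr_gt0 // mulr_gt0.
have m1T : - (a0 * e2 / 8) - m1 * T = kappa.
  rewrite m1E -e2E kE.
  have -> : (2 * E * a0 - 3 / 4 * b * e2) * T =
      2 * a0 * (E * T) - 3 / 4 * (b * T) * e2 by ring.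
  by rewrite ET bT; field.
have hD : (C * be * eta) `^ (p - 1) = 2 * E * eta.
  rewrite Cbe DE divfK ?gt_eqF// powK //.
  by rewrite !mulr_ge0 // ltW.
have hb : 2 * b * eta ^+ 2 <= (a0 / 2 * eta) `^ p.
  have X0 : 0 <= a0 / 2 * eta by rewrite mulr_ge0 ?divr_ge0 // ltW.
  rewrite -mulr_powRB1 //; last lra.
  have X1 : 64 * E / eta <= (a0 / 2 * eta) `^ (p - 1).
    rewrite -[X in X <= _]powK; last by rewrite divr_ge0 ?mulr_ge0 // ltW.
    by rewrite -A1E; apply: ge0_ler_powR; rewrite ?nnegrE // ltW.
  apply: le_trans (ler_wpM2l X0 X1).
  rewrite -e2E -mulrA be2 le_eqVlt; apply/orP; left; apply/eqP.
  by field; rewrite gt_eqF.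
exists (4 * a0 / e2), T, kappa; split => //.
  by rewrite divr_ge0 ?mulr_ge0 // ltW.
move=> Omega c u Ob BO uc uvisc u0 x Bx.
have sx : 0 < depth c eta x by exact/eball_depth.
rewrite leNgt; apply/negP => ux.
have [w wE] : exists w, w = (depth c eta x)^-1 + T^-1 by eexists.
have w0 : 0 < w by rewrite wE addr_gt0 ?invr_gt0.
have [eps epsE] : exists eps, eps =
    Num.min (a0 / 2 * (3 / 4 * eta ^+ 2) ^+ 2) ((kappa - u (x, T)) / w).
  by eexists.
have eps0 : 0 < eps.
  rewrite epsE lt_min -e2E; apply/andP; split; last by rewrite divr_gt0 ?subr_gt0.
  by rewrite mulr_gt0 ?exprn_gt0 ?divr_gt0 ?mulr_gt0.
have eps_small : eps <= a0 / 2 * (3 / 4 * eta ^+ 2) ^+ 2.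
  by rewrite epsE ge_min lexx.
have eps_gap : eps * w <= kappa - u (x, T).
  by rewrite -ler_pdivlMr // epsE ge_min lexx orbT.
have tau0 : 0 < 2 * T by rewrite mulr_gt0.
have btau : b * (2 * T) = a0 / 2 by rewrite mulrCA bT; field.
have WO z : cylinder c eta (2 * T) z -> Omega z.1.
  by move=> [sz _]; apply: BO; exact/eball_depth.
have [m um] := bounded_below_cylinder Omega u (2 * T) Ob (ltW tau0) uc.
have cmp : barrier c eta (- (a0 * e2 / 8)) m1 a0 b C be eps (2 * T) (x, T)
    <= u (x, T).
  apply: (strict_subsolution_le lam Lam p m Omega u (cylinder c eta (2 * T))) => //.
  - exact: cylinder_open.
  - exact: barrier_smooth.
  - move=> z Wz z0; rewrite m1E.
    apply: (barrier_strict_subsolution c p lam Lam eta _ a0 b C be eps (2 * T) E)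
      => //; try exact: ltW.
    by rewrite Cbe -A2E.
  - move=> z Wz z0; apply: um.
      by apply: subset_closure; exact: WO.
    by case: Wz => _ /ltW ->; rewrite z0.
  - apply: barrier_superlevel_compact => //; try exact: ltW.
    exact: bounded_set_sub Ob.
  - move=> [y t] [/= sy _] ->; apply: le_trans (u0 y _); last exact/eball_depth.
    rewrite /barrier /= mulr0 mulr0 !subr0.
    have C1 : C * depth c eta y `^ be <= a0 * e2 / 16.
      apply: le_trans a0A3; rewrite A3E ler_wpM2l ?(ltW C0)//.
      apply: ge0_ler_powR; rewrite ?nnegrE ?(ltW sy) ?(ltW be0) ?sqr_ge0//.
      exact: depth_le.
    (* arithmetic-geometric mean, with the weights that leave a0 eta^2 / 16 *)
    have C2 : a0 * depth c eta y <=
        4 * a0 / e2 * depth c eta y ^+ 2 + a0 * e2 / 16.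
      have : 0 <= a0 / e2 * (2 * depth c eta y - e2 / 4) ^+ 2.
        by rewrite mulr_ge0 ?sqr_ge0 // divr_ge0 // ltW.
      have -> : a0 / e2 * (2 * depth c eta y - e2 / 4) ^+ 2 =
        4 * a0 / e2 * depth c eta y ^+ 2 + a0 * e2 / 16 - a0 * depth c eta y.
        by field; rewrite gt_eqF.
      by rewrite subr_ge0.
    have C3 : 0 <= eps * depth c eta y `^ (- 1).
      by rewrite mulr_ge0 ?powR_ge0 // ltW.
    have C4 : 0 <= eps * (2 * T) `^ (- 1) by rewrite mulr_ge0 ?powR_ge0 // ltW.
    by lra.
  - by split => //=; lra.
  - exact: ltW.
move: cmp; rewrite /barrier /= (_ : 2 * T - T = T); last by ring.
rewrite !powR_inv1 ?(ltW sx) ?(ltW T0)// bT.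
have D1 : 0 < (a0 - a0 / 4) * depth c eta x by rewrite mulr_gt0 //; lra.
have D2 : 0 <= C * depth c eta x `^ be by rewrite mulr_ge0 ?powR_ge0 // ltW.
move: eps_gap; rewrite wE mulrDr; lra.
Qed.

(** * The initial datum *)

(** The derivative 2 max(y, 0) is 2-Lipschitz, hence the first-order Taylor
    remainder is at most h^2, which treats all signs of y at once. *)
Lemma is_derive_pos_part_sqr {R : realType} (y : R) :
  is_derive y 1 (fun t => Num.max t 0 ^+ 2) (2 * Num.max y 0).
Proof.
have taylor h : `|Num.max (h + y) 0 ^+ 2 - Num.max y 0 ^+ 2
    - h * (2 * Num.max y 0)| <= h ^+ 2.
  have [y0|y0] := leP y 0; have [hy|hy] := leP (h + y) 0; rewrite ler_norml;
    apply/andP; split; nra.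
have qcvg : h^-1 *: (((fun t => Num.max t 0 ^+ 2) \o shift y) (h *: (1 : R))
    - Num.max y 0 ^+ 2) @[h --> 0^'] --> 2 * Num.max y 0.
  apply/cvgrPdist_le => e e0; near=> h.
  have h0 : h != 0 by near: h; exact: nbhs_dnbhs_neq.
  rewrite /= [_%:A]mulr1.
  have -> : 2 * Num.max y 0 - h^-1 *: (Num.max (h + y) 0 ^+ 2 - Num.max y 0 ^+ 2)
    = - (h^-1 * (Num.max (h + y) 0 ^+ 2 - Num.max y 0 ^+ 2
                 - h * (2 * Num.max y 0))).
    by rewrite /GRing.scale /=; field.
  rewrite normrN normrM normfV mulrC ler_pdivrMr ?normr_gt0//.
  apply: le_trans (taylor h) _; rewrite -real_normK ?num_real// expr2.
  apply: ler_wpM2r => //; near: h.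
  exact: dnbhs0_le.
by apply: DeriveDef; [apply/cvg_ex; exists (2 * Num.max y 0) | apply: cvg_lim].
Unshelve. all: by end_near. Qed.

Definition bump {R : realType} {n : nat} (c : 'rV[R]_n) (eta L : R)
    (x : 'rV[R]_n) : R :=
  L * Num.max (depth c eta x) 0 ^+ 2.

Lemma is_derive_bump {R : realType} {n : nat} (c : 'rV[R]_n) (eta L : R) x v :
  is_derive x v (bump c eta L)
    (L * (2 * Num.max (depth c eta x) 0
          * - (2 * \sum_i (x 0 i - c 0 i) * v 0 i))).
Proof.
have sd : is_derive x v (depth c eta) (- (2 * \sum_i (x 0 i - c 0 i) * v 0 i)).
  apply: (is_derive_depth_comp c eta id) => i; exact: is_derive_coord.
have d := is_derive_comp1 _ _ _ _ _ _ sd (is_derive_pos_part_sqr _).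
exact: (is_deriveZ L d).
Qed.

Lemma continuous_pos_depth {R : realType} {n : nat} (c : 'rV[R]_n) (eta : R) :
  continuous (fun x => Num.max (depth c eta x) 0).
Proof.
move=> x; apply: (@continuous_max _ _ (depth c eta) (cst 0)).
  exact: depth_continuous.
exact: cst_continuous.
Qed.

Lemma bump_C1 {R : realType} {n : nat} (Omega : set 'rV[R]_n) c eta L :
  C1_closure Omega (bump c eta L).
Proof.
have cs (k : R) : continuous (fun _ : 'rV[R]_n => k) by exact: cst_continuous.
have cM (f g : 'rV[R]_n -> R) : continuous f -> continuous g ->
    continuous (fun x => f x * g x).
  by move=> fc gc x; apply: continuousM; [exact: fc|exact: gc].
have cp := continuous_pos_depth c eta.
split.
  have -> : bump c eta L = fun x =>
      L * (Num.max (depth c eta x) 0 * Num.max (depth c eta x) 0).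
    by apply/funext => x; rewrite /bump expr2.
  by apply: continuous_subspaceT; apply: (cM _ _ (cs L)); exact: cM.
move=> v; split.
  by move=> x _; case: (is_derive_bump c eta L x v).
exists (fun x => L * (2 * Num.max (depth c eta x) 0
                 * - (2 * \sum_i (x 0 i - c 0 i) * v 0 i))); split; last first.
  by move=> x _; case: (is_derive_bump c eta L x v).
have oT : open [set: 'rV[R]_n] by exact: openT.
have [dc _] : Ck 0 setT
    (fun x : 'rV[R]_n => - (2 * \sum_i (x 0 i - c 0 i) * v 0 i)).
  apply: CkN => //; apply: CkM => //; first exact: Ck_cst.
  apply: Ck_sum => // i; apply: CkM => //; last exact: Ck_cst.
  apply: CkB => //; last exact: Ck_cst.
  apply: Ck_linear => //; first exact: continuous_coord.
  by move=> a x y; rewrite !mxE.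
apply: continuous_subspaceT; apply: (cM _ _ (cs L)).
apply: (cM _ _ (cM _ _ (cs 2) cp)).
by move=> x; exact: dc.
Qed.

(** * Loss of the boundary condition *)

(** Otherwise Omega is closed and open, so its trace on a line through one of
    its points is the whole line, which is unbounded. *)
Lemma boundary_nonempty {R : realType} {n : nat} (Omega : set 'rV[R]_n) :
  (0 < n)%N -> bounded_domain Omega -> boundary Omega !=set0.
Proof.
move=> n0 [[x Ox] Oo _ [M [Mr OM]]].
apply: contrapT => /nonemptyPn bd0.
have Oc : closed Omega.
  move=> y Oy; apply: contrapT => nOy.
  have : boundary Omega y by split => // /interior_subset.
  by rewrite bd0.
pose i0 : 'I_n := Ordinal n0.
pose l (h : R) : 'rV[R]_n := h *: delta_mx 0 i0 + x.
have lc : continuous l.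
  move=> h; apply: cvgD; last exact: cvg_cst.
  by apply: cvgZr_tmp; exact: cvg_id.
have lO : l @^-1` Omega = setT.
  have cT : connected [set: R] by apply/connected_intervalP.
  apply: cT.
  - by exists 0; rewrite /preimage /= /l scale0r add0r.
  - by exists (l @^-1` Omega); [exact: open_comp|rewrite setTI].
  - by exists (l @^-1` Omega); [exact: closed_comp|rewrite setTI].
have d0 : 0 < `|delta_mx 0 i0 : 'rV[R]_n|.
  rewrite normr_gt0; apply/eqP => /matrixP /(_ 0 i0) /eqP.
  by rewrite !mxE !eqxx oner_eq0.
have MM : M < `|M| + 1 by rewrite ltr_pwDr // ler_norm.
pose h := (`|M| + 1 + `|x| + 1) / `|delta_mx 0 i0 : 'rV[R]_n|.
have : (l @^-1` Omega) h by rewrite lO.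
move=> /(OM _ MM) /= lh.
have : `|h *: delta_mx 0 i0 : 'rV[R]_n| <= `|M| + 1 + `|x|.
  rewrite -[X in `|X|](addrK x); apply: le_trans (ler_normB _ _) _.
  by rewrite lerD2r.
rewrite normrZ ger0_norm; last by rewrite divr_ge0 ?addr_ge0.
by rewrite /h divfK ?gt_eqF // gerDl ler10.
Qed.

Theorem corollary5p2 (R : realType) (n : nat) (hn : (0 < n)%N)
    (p lam Lam : R) (hp : 2 < p) (hlam : 0 < lam) (hLam : lam < Lam)
    (Omega : set 'rV[R]_n) (hOmega : bounded_domain Omega)
    (hsphere : interior_sphere Omega) :
  exists u0 : 'rV[R]_n -> R,
    [/\ C1_closure Omega u0,
        (forall x, closure Omega x -> 0 <= u0 x),
        (forall x, boundary Omega x -> u0 x = 0)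
      & exists2 T : R, 0 < T &
          forall u : 'rV[R]_n * R -> R,
            is_solution lam Lam p Omega u0 u -> LOBC_at Omega u T].
Proof.
have [x0 bx0] := boundary_nonempty Omega hn hOmega.
have [_ Oo _ Ob] := hOmega.
have [eta eta0 /(_ x0 bx0) [c [BO [clB _]]]] := hsphere.
have [L [T [kappa [L0 T0 k0 grow]]]] :=
  ball_growth n p lam Lam eta hp (ltW hLam) (lt_trans hlam hLam) eta0.
exists (bump c eta L); split.
- exact: bump_C1.
- by move=> x _; rewrite mulr_ge0 // sqr_ge0.
- move=> x [_ nOx].
  rewrite /bump max_r ?expr0n ?mulr0// leNgt; apply/negP => sx.
  by apply: nOx; apply: Oo; apply: BO; exact/eball_depth.
exists T => // u [uc uvisc _ uinit].
have uT : forall x, eball c eta x -> kappa <= u (x, T).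
  apply: (grow Omega) => // x Bx.
  rewrite uinit; last by apply: subset_closure; exact: BO.
  by rewrite /bump max_l //; apply/ltW/eball_depth.
exists x0 => //; rewrite gt_eqF //; apply: lt_le_trans k0 _.
rewrite leNgt; apply/negP => ux0.
have D0 : (closure Omega `*` [set t : R | 0 <= t]) (x0, T).
  by split => /=; [case: bx0|exact: ltW].
have /(_ _ D0) ux0_cvg := (subspace_continuousP _ _).1 uc.
have : nbhs (u (x0, T)) [set y | y < kappa].
  by apply: open_nbhs_nbhs; split; [exact: open_lt|exact: ux0].
move=> /ux0_cvg; rewrite /nbhs /= /within /=.
move=> [[P Q] [/= P0 Q0] PQ].
have [x [Bx Px]] := clB _ P0.
have Dx : (closure Omega `*` [set t : R | 0 <= t]) (x, T).
  by split => /=; [apply: subset_closure; exact: BO|exact: ltW].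
have : u (x, T) < kappa by exact: (PQ (x, T) (conj Px (nbhs_singleton Q0)) Dx).
by rewrite ltNge uT.
Qed.
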